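(* Let $\zeta:\mathbb{R}\to\mathbb{R}$ be continuous and assume either (i) $\zeta$ is not a polynomial, or (ii) $\zeta$ is not affine and there exists $t\in\mathbb{R}$ at which $\zeta$ is continuously differentiable with $\zeta'(t)\neq 0$. Let $N, D$ be positive integers and fix $0<\varsigma<1/(9D^{3/2})$. Let $\mathcal{G}$ be the complete graph on $N$ nodes, let $\tilde{\mathbf{A}} = \big(\mathbb{1}_{i\sim j \vee i=j}/\sqrt{\deg(v_i)\deg(v_j)}\big)_{i,j=1}^N$, let $\mathbf{W}$ be a $D\times D$ random matrix with i.i.d. entries $W_{i,j}\sim N(0,\varsigma^2)$, and let $\mathcal{L}^{\mathrm{conv+r}}_{\mathcal{G},\mathbf{W}}(\mathbf{X}) = \tilde{\mathbf{A}}\mathbf{X}\mathbf{W} + \mathbf{X}$. Then, with probability at least $1-e^{-D/2}$, the class of maps $\hat f:\mathbb{R}^{N\times D}\to\mathbb{R}$ of the form $\hat f = \mathrm{MLP}\circ\mathcal{L}^{\mathrm{conv+r}}_{\mathcal{G},\mathbf{W}}$, where $\mathrm{MLP}:\mathbb{R}^{N\times D}\to\mathbb{R}$ ranges over multilayer perceptrons with activation function $\zeta$, is dense in $\mathcal{C}(\mathbb{R}^{N\times D},\mathbb{R})$ for the topology of uniform convergence on compact sets.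
   Context: $i\sim j$ means $v_i$ and $v_j$ are adjacent; degrees count the self-loop, so that for the complete graph every entry of $\tilde{\mathbf{A}}$ equals $1/N$. MLPs take the matrix input (viewed as a vector in $\mathbb{R}^{ND}$) to a real number. *)

(* Defs.v *)
From HB Require Import structures.
From mathcomp Require Import all_boot all_order all_algebra.
From mathcomp Require Import all_classical all_reals all_analysis.
Set Implicit Arguments. Unset Strict Implicit. Unset Printing Implicit Defensive.
Import Order.TTheory GRing.Theory Num.Theory.
Import numFieldNormedType.Exports.
Local Open Scope classical_set_scope.
Local Open Scope ring_scope.

(* A simple graph on nodes 'I_N is given by an adjacency relation e;    *)
(* deg(v_i) counts the self-loop: #{ j | i ~ j \/ i = j }.              *)
Definition gdeg (N : nat) (e : rel 'I_N) (i : 'I_N) : nat :=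
  #|[set j | e i j || (i == j)]|.

Definition norm_adj (R : realType) (N : nat) (e : rel 'I_N) : 'M[R]_N :=
  \matrix_(i, j) (if e i j || (i == j)
                  then (Num.sqrt ((gdeg e i)%:R * (gdeg e j)%:R))^-1
                  else 0).

Definition complete_graph (N : nat) : rel 'I_N := fun i j => i != j.

Definition conv_res (R : realType) (N D : nat) (e : rel 'I_N)
    (W : 'M[R]_D) (X : 'M[R]_(N, D)) : 'M[R]_(N, D) :=
  norm_adj R e *m X *m W + X.

Inductive mlp (R : realType) : nat -> Type :=
| MLPOut (n : nat) (a : 'cV[R]_n) (b : R) : mlp R n
| MLPHidden (n m : nat) (A : 'M[R]_(n, m)) (b : 'rV[R]_m) (rest : mlp R m) :
    mlp R n.

Fixpoint mlp_eval (R : realType) (zeta : R -> R) (n : nat) (f : mlp R n)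
  : 'rV[R]_n -> R :=
  match f with
  | MLPOut _ a b => fun x => (x *m a) 0 0 + b
  | MLPHidden _ _ A b rest => fun x => mlp_eval zeta rest (map_mx zeta (x *m A + b))
  end.

Definition mlp_has_hidden (R : realType) (n : nat) (f : mlp R n) : bool :=
  if f is MLPHidden _ _ _ _ _ then true else false.

Definition dense_ucc (R : realType) (N D : nat)
    (F : set ('M[R]_(N, D) -> R)) : Prop :=
  forall f : 'M[R]_(N, D) -> R, continuous f ->
  forall K : set 'M[R]_(N, D), compact K ->
  forall eps : R, 0 < eps ->
  exists2 g, F g & forall X, K X -> `|f X - g X| < eps.

Definition gnn_class (R : realType) (zeta : R -> R) (N D : nat)
    (e : rel 'I_N) (W : 'M[R]_D) : set ('M[R]_(N, D) -> R) :=
  [set g | exists net : mlp R (N * D),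
     mlp_has_hidden net /\
     g = fun X => mlp_eval zeta net (mxvec (conv_res e W X))].

Definition is_polynomial_fun (R : realType) (zeta : R -> R) : Prop :=
  exists p : {poly R}, forall x, zeta x = p.[x].

Definition is_affine_fun (R : realType) (zeta : R -> R) : Prop :=
  exists a b : R, forall x, zeta x = a * x + b.

Definition C1_at (R : realType) (zeta : R -> R) (t : R) : Prop :=
  (\forall x \near t, derivable zeta x 1) /\ {for t, continuous (derive1 zeta)}.

Definition mutually_independent_entries d (T : measurableType d)
    (R : realType) (P : probability T R) (D : nat)
    (W : 'I_D -> 'I_D -> T -> R) : Prop :=
  forall B : 'I_D -> 'I_D -> set R, (forall i j, measurable (B i j)) ->
  P [set w | forall i j, B i j (W i j w)] =
  (\prod_(i < D) \prod_(j < D) P (W i j @^-1` B i j))%E.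

Definition iid_gaussian_matrix d (T : measurableType d)
    (R : realType) (P : probability T R) (D : nat) (s : R)
    (W : 'I_D -> 'I_D -> T -> R) : Prop :=
  (forall i j, measurable_fun setT (W i j)) /\
  (forall i j (A : set R), measurable A ->
     P (W i j @^-1` A) = normal_prob 0 s A) /\
  mutually_independent_entries P W.

(* Main.v *)
Require Import Defs.
From HB Require Import structures.
From mathcomp Require Import all_boot all_order all_algebra.
From mathcomp Require Import all_classical all_reals all_analysis.
From mathcomp Require Import measurable_realfun ring lra.
Import Order.TTheory GRing.Theory Num.Theory.
Import numFieldNormedType.Exports.
Local Open Scope classical_set_scope.
Local Open Scope ring_scope.

(** Either hypothesis on the activation makes [zeta] continuous and not affine.
    Then [x ^+ 2] is a locally uniform limit of sums of terms [c * zeta (w * x + b)]: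
    summing [zeta] twice over a fine grid yields a function whose small-scale second
    difference is a large-scale second difference of [zeta], which is nonzero
    somewhere.  Translating [x ^+ 2] also gives the identity, so the closure of deep
    networks is an algebra; it is therefore closed under absolute values and minima,
    and a continuous function on a compact set is a uniform limit of minima of
    finitely many cones.

    For the complete graph the normalized adjacency matrix [A] is idempotent, so
    [X |-> A X W + X] is invertible as soon as [1 + W] is, with inverse
    [Y |-> Y - A Y (1 + W)^-1 W].  If all entries of [W] are at most
    [9 s sqrt D < 1 / D] in absolute value then [1 + W] is invertible, and a Gaussian
    tail estimate with a union bound over the [D ^ 2] entries controls the
    probability that this fails. *)

(** * Affine functions and second differences *)

Section second_difference.
Context {R : realType}.
Implicit Types (f : R -> R) (x y h : R).

Lemma continuous_bounded_segment f (B : R) : continuous f ->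
  exists2 M, 0 <= M & forall x, `|x| <= B -> `|f x| <= M.
Proof.
move=> cf; have [B0|B0] := ltP B 0.
  by exists 0 => // x xB; have := normr_ge0 x; lra.
have BB : - B <= B by lra.
have cnf : {within `[- B, B], continuous (fun x => `|f x|)}.
  apply: continuous_subspaceT => x.
  exact: (continuous_comp (@cf x) (@norm_continuous _ R^o _)).
have [c _ cM] := EVT_max BB cnf.
exists `|f c| => // x; rewrite ler_norml => xB.
by apply: cM; rewrite in_itv.
Qed.

(** Only [x] is confined to the segment and [y] may leave it; the near-covering form of compactness
    gives this directly. *)
Lemma continuous_unif_segment f (B e : R) : continuous f -> 0 < e ->
  exists2 d, 0 < d & forall x y,
    `|x| <= B -> `|x - y| <= d -> `|f x - f y| <= e.
Proof.
move=> cf e0.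
have := @segment_compact _ (- B) B.
rewrite compact_near_coveringP => /(_ _ (0^'+)
  (fun d x => forall y, `|x - y| <= d -> `|f x - f y| <= e) _).
case=> [x _|d /= d0 dP].
  have /cvgrPdist_lt/(_ (e / 2)) := @cf x.
  rewrite divr_gt0// => /(_ isT) /nbhs_ballP[d /= d0 dP].
  exists (ball x (d / 2), [set z | 0 < z < d / 2]) => /=.
    split; first by apply: nbhsx_ballx; lra.
    near=> z; rewrite /=; apply/andP; split; near: z.
      exact: nbhs_right_gt.
    by apply: nbhs_right_lt; lra.
  case=> z z' /= [xz /andP[z'0 z'd]] y zy.
  have fz : `|f x - f z| < e / 2 by apply: dP; apply: le_ball xz; lra.
  have fy : `|f x - f y| < e / 2.
    apply: dP; rewrite /ball/=; move: xz; rewrite /ball/= => xz.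
    rewrite -(subrKA z) (le_lt_trans (ler_normD _ _))//; lra.
  rewrite -(subrKA (f x)) (le_trans (ler_normD _ _))// distrC; lra.
exists (d / 2); first by rewrite divr_gt0.
move=> x y; rewrite ler_norml => xB xy.
apply: (dP (d / 2)) => //=; rewrite ?divr_gt0 ?in_itv//.
by rewrite sub0r normrN gtr0_norm; lra.
Unshelve. all: by end_near. Qed.

(* After subtracting the chord through 0 and 1, [f] becomes additive and
   1-periodic, hence bounded, hence zero. *)
Lemma midpoint_affine f : continuous f ->
  (forall x h, f (x + h) + f (x - h) = 2 * f x) -> is_affine_fun f.
Proof.
move=> cf mid; pose g x := f x - (f 1 - f 0) * x - f 0.
have g0 : g 0 = 0 by rewrite /g; lra.
have g1 : g 1 = 0 by rewrite /g; lra.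
have gmid x h : g (x + h) + g (x - h) = 2 * g x.
  by have := mid x h; rewrite /g; lra.
have gdbl x : g (x + x) = 2 * g x.
  by have := gmid x x; rewrite subrr g0 addr0.
have gD x y : g (x + y) = g x + g y.
  have := gmid ((x + y) / 2) ((x - y) / 2).
  have := gdbl ((x + y) / 2).
  have -> : (x + y) / 2 + (x + y) / 2 = x + y by lra.
  have -> : (x + y) / 2 + (x - y) / 2 = x by lra.
  have -> : (x + y) / 2 - (x - y) / 2 = y by lra.
  lra.
have gn n x : g (n%:R * x) = n%:R * g x.
  elim: n => [|n IH]; first by rewrite !mul0r g0.
  by rewrite -natr1 !mulrDl gD IH !mul1r.
have gN x : g (- x) = - g x by have := gD x (- x); rewrite subrr g0; lra.
have gz (m : int) : g m%:~R = 0.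
  have gnat n : g n%:R = 0 by have := gn n 1; rewrite mulr1 g1 mulr0.
  by case: m => n; [exact: gnat|rewrite NegzE mulrNz gN gnat oppr0].
have cg : continuous g.
  move=> x; apply: cvgB; last exact: cvg_cst.
  apply: cvgB; first exact: cf.
  by apply: cvgM; [exact: cvg_cst|exact: cvg_id].
have [M M0 gM] := continuous_bounded_segment _ 1 cg.
have {}gM x : `|g x| <= M.
  rewrite -(subrK (Num.floor x)%:~R x) gD gz addr0; apply: gM.
  have /andP[] := floor_itv x.
  rewrite intrD ler_norml; lra.
suff gx0 x : g x = 0.
  by exists (f 1 - f 0), (f 0) => x; have := gx0 x; rewrite /g; lra.
apply/eqP; rewrite -normr_eq0; apply/negPn/negP => gx.
have gx0 : 0 < `|g x| by rewrite lt_def gx normr_ge0.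
have := archi_boundP (divr_ge0 M0 (ltW gx0)).
set n := Num.bound _; rewrite ltr_pdivrMr// => Mn.
by have := gM (n%:R * x); rewrite gn normrM normr_nat leNgt Mn.
Qed.

Lemma nonaffine_second_difference f : continuous f -> ~ is_affine_fun f ->
  exists x h, 0 < h /\ f (x + h) + f (x - h) - 2 * f x != 0.
Proof.
move=> cf naf; apply: contrapT => H; apply: naf; apply: midpoint_affine => //.
move=> x h; apply/eqP; rewrite -subr_eq0; apply/negPn/negP => xh.
apply: H; have [h0|h0|h0] := ltgtP h 0.
- by exists x, (- h); split; [lra|rewrite opprK (addrC (f (x - h)))].
- by exists x, h.
- by case/eqP: xh; rewrite h0 addr0 subr0; lra.
Qed.

End second_difference.

(** * One-hidden-layer functions of one variable and the square *)

Section square.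
Context {R : realType}.
Variable zeta : R -> R.
Implicit Types (f g : R -> R) (x y d : R).

(** Generated inductively, so that stability under affine changes of variable and composition with
    deep networks follow by induction. *)
Inductive shallow : (R -> R) -> Prop :=
| shallow_act w b : shallow (fun x => zeta (w * x + b))
| shallow_cst c : shallow (fun=> c)
| shallow_add f g : shallow f -> shallow g -> shallow (fun x => f x + g x)
| shallow_scale c f : shallow f -> shallow (fun x => c * f x).

Lemma shallow_ext f g : f =1 g -> shallow f -> shallow g.
Proof. by move/funext->. Qed.

Lemma shallow_sum (I : Type) (r : seq I) (F : I -> R -> R) :
  (forall i, shallow (F i)) -> shallow (fun x => \sum_(i <- r) F i x).
Proof.
move=> sF; elim: r => [|i r IH].
  by apply: shallow_ext (shallow_cst 0) => x; rewrite big_nil.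
apply: shallow_ext (shallow_add _ _ (sF i) IH) => x.
by rewrite big_cons.
Qed.

Lemma shallow_affine_arg f w b : shallow f -> shallow (fun x => f (w * x + b)).
Proof.
elim=> [w' b'|c|{}f g _ sf _ sg|c {}f _ sf].
- apply: shallow_ext (shallow_act (w' * w) (w' * b + b')) => x.
  by congr zeta; ring.
- exact: shallow_cst.
- exact: shallow_add sf sg.
- exact: shallow_scale sf.
Qed.

Definition ap_sum f d (n : nat) y := \sum_(i < n) f (y + i%:R * d).

Lemma ap_sum_step f d n y :
  ap_sum f d n (y + d) - ap_sum f d n y = f (y + n%:R * d) - f y.
Proof.
elim: n => [|n IH]; first by rewrite /ap_sum !big_ord0 mul0r addr0 !subrr.
move: IH; rewrite /ap_sum !big_ord_recr/= -natr1.
have -> : y + d + n%:R * d = y + (n%:R + 1) * d by ring.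
lra.
Qed.

(** Convolution with a discrete hat: [f (y + k d)] has weight [n - |k|]. The step [- d] of the outer
    sum keeps it centred at [y]. *)
Definition box_sum f d n := ap_sum (ap_sum f d n) (- d) n.

(* Both summations telescope, so the second difference of [box_sum f d n] at
   the small scale [d] is that of [f] at the large scale [n d]. *)
Lemma box_sum_second_difference f d n y :
  box_sum f d n (y + d) + box_sum f d n (y - d) - 2 * box_sum f d n y =
  f (y + n%:R * d) + f (y - n%:R * d) - 2 * f y.
Proof.
have step z : box_sum f d n (z + d) - box_sum f d n z =
    ap_sum f (- d) n (z + n%:R * d) - ap_sum f (- d) n z.
  rewrite /box_sum {1 2 4 5}/ap_sum -!sumrB; apply: eq_bigr => i _.
  rewrite (addrAC z d) ap_sum_step; congr (f _ - _); ring.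
have := step (y - d); rewrite subrK; have := step y.
have := ap_sum_step f (- d) n (y + n%:R * d).
have := ap_sum_step f (- d) n y.
have -> : y + n%:R * d + n%:R * - d = y by ring.
have -> : y - d + n%:R * d = y + n%:R * d - d by ring.
have -> : y + n%:R * - d = y - n%:R * d by ring.
lra.
Qed.

Lemma shallow_box_sum d n : shallow (box_sum zeta d n).
Proof.
apply: shallow_sum => i; apply: shallow_sum => j.
apply: shallow_ext (shallow_act 1 (i%:R * - d + j%:R * d)) => x.
by congr zeta; ring.
Qed.

Lemma box_sum_dist f d n (e : R) y z :
  (forall i j : 'I_n, `|f (y + (i%:R - j%:R) * d) - f (z + (i%:R - j%:R) * d)| <= e) ->
  `|box_sum f d n y - box_sum f d n z| <= n%:R ^+ 2 * e.
Proof.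
move=> H; rewrite /box_sum /ap_sum -sumrB.
have -> : n%:R ^+ 2 * e = \sum_(i < n) \sum_(j < n) e.
  by rewrite !sumr_const !card_ord -mulrnA -[RHS]mulr_natl natrM expr2.
apply: le_trans (ler_norm_sum _ _ _) _; apply: ler_sum => j _.
rewrite -sumrB.
apply: le_trans (ler_norm_sum _ _ _) _; apply: ler_sum => i _.
have := H i j; congr (`|f _ - f _| <= e); ring.
Qed.

(** Subtracting [c k^2] leaves a sequence that vanishes at 0 and 1 and has second differences at
    most [2 e] in absolute value. Its increments are then at most [2 e k], a bound carried along in
    the induction. *)
Lemma second_difference_quadratic (u : nat -> R) (c e : R) (m : nat) :
  0 <= e -> u 0%N = 0 -> u 1%N = c ->
  (forall k, (k < m)%N -> `|u k.+2 - 2 * u k.+1 + u k - 2 * c| <= 2 * e) ->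
  forall k, (k <= m)%N -> `|u k - c * k%:R ^+ 2| <= e * k%:R ^+ 2.
Proof.
move=> e0 u0 u1 H k km.
suff [] : `|u k - c * k%:R ^+ 2| <= e * k%:R ^+ 2 /\
  `|u k.+1 - c * k.+1%:R ^+ 2 - (u k - c * k%:R ^+ 2)| <= 2 * e * k%:R by [].
elim: k km => [|k IH] km.
  by rewrite u0 u1 !(expr0n, mulr0, subr0, expr1n, mulr1, subrr, normr0).
have {IH}[IH1 IH2] := IH (ltnW km); have := H _ km.
rewrite -!natr1 in IH2 *; set a := k%:R in IH1 IH2 *.
move: IH1 IH2; rewrite !ler_norml => /andP[a1 a2] /andP[b1 b2] /andP[c1 c2].
by split; apply/andP; split; nra.
Qed.

(* [box_sum] on the grid of mesh [h / n] is quadratic up to a small error near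
   a point where the second difference [c] of [zeta] at scale [h] is nonzero;
   uniform continuity of [zeta] takes care of the points off the grid. *)
Lemma shallow_sqr (A e : R) : continuous zeta -> ~ is_affine_fun zeta ->
  0 < e -> exists2 g, shallow g & forall x, `|x| <= A -> `|g x - x ^+ 2| <= e.
Proof.
move=> cz naz e0.
wlog A0 : A / 0 < A.
  move=> /(_ (`|A| + 1)) []; first by have := normr_ge0 A; lra.
  by move=> g sg gP; exists g => // x xA; apply: gP; have := ler_norm A; lra.
have [x0 [h [h0 c0]]] := nonaffine_second_difference _ cz naz.
set c := (X in X != 0) in c0.
have nc0 : 0 < `|c| by rewrite normr_gt0.
(* [eta], [om] and the mesh bound in [d'] are tuned so that each of the three final error terms is
   at most [e / 3]. *)
pose eta := e * `|c| / (3 * A ^+ 2).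
have eta0 : 0 < eta by rewrite divr_gt0 ?mulr_gt0 ?exprn_gt0.
have [e1 e10 e1P] : exists2 e1, 0 < e1 & forall y, `|y| <= e1 ->
    `|zeta (x0 + y + h) + zeta (x0 + y - h) - 2 * zeta (x0 + y) - c| <= eta.
  have [|d d0 dP] := continuous_unif_segment zeta (`|x0| + h) (eta / 4) cz.
    by rewrite divr_gt0.
  exists d => // y yd.
  have P z : `|z| <= `|x0| + h -> `|zeta z - zeta (z + y)| <= eta / 4.
    by move=> zB; apply: dP => //; rewrite opprD addrA subrr sub0r normrN.
  have := P x0; have := P (x0 + h); have := P (x0 - h).
  rewrite lerDl (ltW h0) => P1 P2 /(_ isT) P3.
  have {}P1 := P1 ltac:(rewrite (le_trans (ler_normB _ _))// (gtr0_norm h0)//).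
  have {}P2 := P2 ltac:(rewrite (le_trans (ler_normD _ _))// (gtr0_norm h0)//).
  move: P1 P2 P3; rewrite /c (addrAC x0 y h) (addrAC x0 y (- h)) !ler_norml.
  lra.
pose om := e * e1 ^+ 2 * `|c| / (6 * A ^+ 2 * h ^+ 2).
have om0 : 0 < om by rewrite divr_gt0 ?mulr_gt0 ?exprn_gt0.
have [d d0 dP] := continuous_unif_segment zeta (`|x0| + e1 + h) om cz om0.
pose d' := Num.min d (e * e1 / (6 * A ^+ 2)).
have d'0 : 0 < d' by rewrite lt_min d0 divr_gt0 ?mulr_gt0 ?exprn_gt0.
have [n n1 nd'] : exists2 n : nat, (0 < n)%N & h / d' <= n%:R.
  exists (Num.bound (h / d')).+1 => //.
  apply: le_trans (ltW (archi_boundP _)) _; last by rewrite ler_nat.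
  by rewrite divr_ge0// ltW.
have n0 : 0 < n%:R :> R by rewrite ltr0n.
pose dl := h / n%:R.
have dl0 : 0 < dl by rewrite divr_gt0.
have ndl : n%:R * dl = h by rewrite mulrC divfK// gt_eqF.
have /andP[dld dle] : (dl <= d) && (dl <= e * e1 / (6 * A ^+ 2)).
  by rewrite -le_min -/d' ler_pdivrMr// mulrC -ler_pdivrMr.
(* [U] is even, vanishes at 0 and equals [c] at [dl]. On the grid its second differences are sums of
   two second differences of [zeta] at scale [h] near [x0], so about [2 c]; hence [U (k dl)] is
   about [c k^2]. *)
pose U y := box_sum zeta dl n (x0 + y) + box_sum zeta dl n (x0 - y)
              - 2 * box_sum zeta dl n x0.
(* A point [x] of [[-A, A]] is sent to [e1 / A * x] in [[-e1, e1]], where [U y] is about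
   [c (y / dl)^2]; the factor [K] turns this into [x ^+ 2]. *)
pose K := dl ^+ 2 * A ^+ 2 / (e1 ^+ 2 * c).
exists (fun x => K * U (e1 / A * x)).
  apply: shallow_scale; apply: shallow_add; last exact: shallow_cst.
  apply: shallow_add.
    apply: shallow_ext (shallow_affine_arg _ (e1 / A) x0 (shallow_box_sum dl n)).
    by move=> x; rewrite addrC.
  apply: shallow_ext (shallow_affine_arg _ (- (e1 / A)) x0 (shallow_box_sum dl n)).
  by move=> x; rewrite addrC mulNr.
move=> x xA.
have UN y : U (- y) = U y by rewrite /U opprK (addrC (box_sum zeta dl n (x0 - y))).
pose y := e1 / A * `|x|.
have eA0 : 0 < e1 / A by rewrite divr_gt0.
have y0 : 0 <= y by rewrite mulr_ge0// ltW.
have ye1 : y <= e1 by rewrite /y mulrAC ler_pdivrMr// ler_pM2l.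
have -> : U (e1 / A * x) = U y.
  by rewrite /y; case: (ger0P x) => // _; rewrite mulrN UN.
pose r := y / dl.
have r0 : 0 <= r by rewrite divr_ge0// ltW.
have yr : y = r * dl by rewrite divfK// gt_eqF.
have re1 : r <= e1 / dl by rewrite ler_pM2r// invr_gt0.
have /andP[kr rk] := truncn_itv r0; set k := Num.truncn r in kr rk.
have k0 : 0 <= k%:R :> R by [].
have idl (i j : 'I_n) : `|(i%:R - j%:R) * dl| <= h.
  rewrite -ndl normrM (gtr0_norm dl0) ler_pM2r//.
  have : (i%:R <= n%:R :> R) && (j%:R <= n%:R :> R).
    by rewrite !ler_nat (ltnW (ltn_ord i)) (ltnW (ltn_ord j)).
  have : (0 <= i%:R :> R) && (0 <= j%:R :> R) by rewrite !ler0n.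
  by rewrite ler_norml; lra.
have Uk : `|U (k%:R * dl) - c * k%:R ^+ 2| <= eta * k%:R ^+ 2.
  apply: (second_difference_quadratic (fun k => U (k%:R * dl)) c eta k) => //.
  - exact: ltW.
  - by rewrite /U mul0r addr0 subr0; ring.
  - by rewrite /U mul1r box_sum_second_difference ndl.
  move=> j jk.
  have jdl : `|j.+1%:R * dl| <= e1.
    rewrite normrM normr_nat (gtr0_norm dl0) (le_trans _ ye1)// yr ler_pM2r//.
    by rewrite (le_trans _ kr)// ler_nat.
  have := box_sum_second_difference zeta dl n (x0 + j.+1%:R * dl).
  have := box_sum_second_difference zeta dl n (x0 - j.+1%:R * dl).
  have := e1P _ jdl; have := e1P (- (j.+1%:R * dl)); rewrite normrN => /(_ jdl).
  rewrite ndl /U !ler_norml.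
  have -> : x0 - j.+1%:R * dl + dl = x0 - j%:R * dl by rewrite -natr1; ring.
  have -> : x0 - j.+1%:R * dl - dl = x0 - j.+2%:R * dl by rewrite -!natr1; ring.
  have -> : x0 + j.+1%:R * dl + dl = x0 + j.+2%:R * dl by rewrite -!natr1; ring.
  have -> : x0 + j.+1%:R * dl - dl = x0 + j%:R * dl by rewrite -!natr1; ring.
  lra.
have kyd : `|y - k%:R * dl| <= dl.
  rewrite yr -mulrBl normrM (gtr0_norm dl0) ler_piMl ?(ltW dl0)//.
  by move: rk; rewrite -natr1 ler_norml; lra.
have xB (i j : 'I_n) z : `|z| <= e1 ->
    `|x0 + z + (i%:R - j%:R) * dl| <= `|x0| + e1 + h.
  move=> ze; rewrite (le_trans (ler_normD _ _))// lerD//.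
  by rewrite (le_trans (ler_normD _ _))// lerD2l.
have ny : `|y| <= e1 by rewrite ger0_norm.
have Uy : `|U y - U (k%:R * dl)| <= 2 * (n%:R ^+ 2 * om).
  have B1 : `|box_sum zeta dl n (x0 + y) - box_sum zeta dl n (x0 + k%:R * dl)|
      <= n%:R ^+ 2 * om.
    apply: box_sum_dist => i j; apply: dP; first exact: xB.
    by apply: le_trans dld; rewrite opprD addrACA subrr addr0 opprD addrACA subrr
         add0r.
  have B2 : `|box_sum zeta dl n (x0 - y) - box_sum zeta dl n (x0 - k%:R * dl)|
      <= n%:R ^+ 2 * om.
    apply: box_sum_dist => i j; apply: dP; first by apply: xB; rewrite normrN.
    by apply: le_trans dld; rewrite opprD addrACA subrr addr0 opprD addrACA subrr
         add0r -opprD normrN.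
  by move: B1 B2; rewrite /U !ler_norml; lra.
have Kx : x ^+ 2 = K * (c * r ^+ 2).
  rewrite /K /r /y -(real_normK (num_real x)); field.
  by rewrite c0 !gt_eqF.
have kr2 : k%:R ^+ 2 <= r ^+ 2 by rewrite lerXn2r ?nnegrE.
rewrite Kx -mulrBr normrM.
have nK : `|K| = dl ^+ 2 * A ^+ 2 / (e1 ^+ 2 * `|c|).
  have -> : K = (dl * A / e1) ^+ 2 / c by rewrite /K; field; rewrite c0 gt_eqF.
  rewrite normrM normfV ger0_norm ?sqr_ge0//; field.
  by rewrite !gt_eqF.
have nK0 : 0 <= `|K| by [].
(* Three errors: rounding the argument of [U] to the grid, deviation from the parabola on the grid,
   and replacing [k] by [r], where [r ^+ 2 - k ^+ 2 <= 2 r]. *)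
have main : `|U y - c * r ^+ 2| <=
    2 * (n%:R ^+ 2 * om) + eta * (e1 / dl) ^+ 2 + `|c| * (2 * (e1 / dl)).
  have -> : U y - c * r ^+ 2 = (U y - U (k%:R * dl)) +
    (U (k%:R * dl) - c * k%:R ^+ 2) + c * (k%:R ^+ 2 - r ^+ 2) by ring.
  apply: le_trans (ler_normD _ _) _; apply: lerD; last first.
    rewrite normrM ler_pM2l// ler0_norm ?subr_le0//.
    apply: (@le_trans _ _ (2 * r)); last by rewrite ler_pM2l.
    by move: rk; rewrite -natr1; nra.
  apply: le_trans (ler_normD _ _) _; apply: lerD => //.
  apply: le_trans Uk _; rewrite ler_pM2l// (le_trans kr2)//.
  by rewrite lerXn2r ?nnegrE// (le_trans r0).
apply: le_trans (ler_wpM2l nK0 main) _.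
have -> : `|K| * (2 * (n%:R ^+ 2 * om) + eta * (e1 / dl) ^+ 2
    + `|c| * (2 * (e1 / dl))) = e / 3 + e / 3 + 2 * A ^+ 2 / e1 * dl.
  rewrite nK /om /eta /dl; field.
  by rewrite !gt_eqF// ltr0n.
have : 2 * A ^+ 2 / e1 * dl <= e / 3.
  rewrite -ler_pdivlMl ?divr_gt0 ?mulr_gt0 ?exprn_gt0//.
  apply: le_trans dle _; rewrite le_eqVlt; apply/orP; left; apply/eqP; field.
  by rewrite !gt_eqF.
lra.
Qed.

End square.

(** * Closure properties of multilayer perceptrons *)

Section networks.
Context {R : realType}.
Variable zeta : R -> R.

(** The affine map is absorbed into the weights and bias of the first layer. *)
Lemma mlp_affine_input m p (A : 'M[R]_(p, m)) (b : 'rV[R]_m) (net : mlp R m) :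
  exists2 net' : mlp R p, mlp_has_hidden net' = mlp_has_hidden net &
    forall x, mlp_eval zeta net' x = mlp_eval zeta net (x *m A + b).
Proof.
case: m / net A b => [m a c|m q B c rest] A b.
  exists (MLPOut (A *m a) ((b *m a) 0 0 + c)) => // x /=.
  by rewrite mulmxDl mulmxA [in RHS]mxE addrA.
exists (MLPHidden (A *m B) (b *m B + c) rest) => // x /=.
by rewrite mulmxDl mulmxA addrA.
Qed.

Variable n : nat.

(** Vector-valued networks with [k] hidden layers, unfolded from the output side, whereas [mlp] is
    unfolded from the input side; in this form outputs can be joined and post-composed. *)
Fixpoint vnet (k m : nat) (phi : 'rV[R]_n -> 'rV[R]_m) : Prop :=
  match k with
  | 0%N => exists A b, forall x, phi x = x *m A + b
  | k'.+1 => exists p (psi : 'rV[R]_n -> 'rV[R]_p) A b,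
      vnet k' p psi /\ forall x, phi x = map_mx zeta (psi x) *m A + b
  end.

Lemma vnet_affine_output k m p (phi : 'rV[R]_n -> 'rV[R]_m) (A : 'M[R]_(m, p)) b :
  vnet k m phi -> vnet k p (fun x => phi x *m A + b).
Proof.
case: k => [[B [c phiE]]|k [q [psi [B [c [vpsi phiE]]]]]].
  exists (B *m A), (c *m A + b) => x.
  by rewrite phiE mulmxDl mulmxA addrA.
exists q, psi, (B *m A), (c *m A + b); split=> // x.
by rewrite phiE mulmxDl mulmxA addrA.
Qed.

(** Networks of equal depth run in parallel on a shared input, with block-diagonal weights. *)
Lemma vnet_row_mx k m p phi psi : vnet k m phi -> vnet k p psi ->
  vnet k (m + p) (fun x => row_mx (phi x) (psi x)).
Proof.
elim: k m p phi psi => [|k IH] m p phi psi.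
  move=> [A [b phiE]] [B [c psiE]].
  exists (row_mx A B), (row_mx b c) => x.
  by rewrite phiE psiE mul_mx_row add_row_mx.
move=> [q [f [A [b [vf phiE]]]]] [r [g [B [c [vg psiE]]]]].
exists (q + r)%N, (fun x => row_mx (f x) (g x)), (block_mx A 0 0 B), (row_mx b c).
split; first exact: IH.
move=> x; rewrite phiE psiE map_row_mx mul_row_block !mulmx0 addr0 add0r.
by rewrite add_row_mx.
Qed.

Lemma vnet_cst k m (c : 'rV[R]_m) : vnet k m (fun=> c).
Proof.
elim: k m c => [|k IH] m c.
  by exists 0, c => x; rewrite mulmx0 add0r.
by exists m, (fun=> c), 0, c; split=> // x; rewrite mulmx0 add0r.
Qed.

(** The layers of [phi] are moved one at a time to the front of [net]. The boolean implication
    ensures a hidden layer in the result as soon as [phi] or [net] has one. *)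
Lemma vnet_mlp k m phi (net : mlp R m) : vnet k m phi ->
  exists2 net' : mlp R n, ((0 < k)%N || mlp_has_hidden net) ==> mlp_has_hidden net' &
    forall x, mlp_eval zeta net' x = mlp_eval zeta net (phi x).
Proof.
elim: k m phi net => [|k IH] m phi net.
  move=> [A [b phiE]]; have [net' h' e'] := mlp_affine_input _ _ A b net.
  by exists net' => [|x]; rewrite ?h' ?implybb// e' phiE.
move=> [q [psi [A [b [vpsi phiE]]]]].
have [net1 h1 e1] := mlp_affine_input _ _ A b net.
(* Identity weights and zero bias make this layer apply [zeta] alone to [psi x]; [net1] has already
   absorbed [A] and [b]. *)
have [net' h' e'] := IH _ _ (MLPHidden 1%:M 0 net1) vpsi.
exists net'; first by move: h'; rewrite /= orbT.
by move=> x; rewrite e' /= mulmx1 addr0 e1 phiE.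
Qed.

(** The index is the exact number of hidden layers: sums need equal depths, and in the absence of an
    exact identity layer only constants come at every depth. *)
Inductive deep : nat -> ('rV[R]_n -> R) -> Prop :=
| deep_affine a b : deep 0 (fun x => (x *m a : 'cV[R]_1) 0 0 + b)
| deep_cst k c : deep k (fun=> c)
| deep_add k f g : deep k f -> deep k g -> deep k (fun x => f x + g x)
| deep_scale k c f : deep k f -> deep k (fun x => c * f x)
| deep_act k f : deep k f -> deep k.+1 (fun x => zeta (f x)).

Lemma deep_vnet k f : deep k f -> vnet k 1 (fun x => (f x)%:M).
Proof.
elim=> {k f} [a b|k c|k f g _ vf _ vg|k c f _ vf|k f _ vf].
- exists a, b%:M => x.
  by apply/rowP => i; rewrite !ord1 !mxE eqxx !mulr1n.
- exact: vnet_cst.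
(* The column of two identities adds the two parallel outputs. *)
- have := vnet_affine_output _ _ _ _ (col_mx 1%:M 1%:M) 0 (vnet_row_mx _ _ _ _ _ vf vg).
  congr vnet; apply/funext => x.
  by rewrite mul_row_col !mulmx1 addr0 raddfD.
- have := vnet_affine_output _ _ _ _ c%:M 0 vf.
  congr vnet; apply/funext => x.
  by rewrite addr0 -scalar_mxM mulrC.
- exists 1%N, (fun x => (f x)%:M), 1%:M, 0; split=> // x.
  by rewrite mulmx1 addr0; apply/rowP => i; rewrite !ord1 !mxE eqxx !mulr1n.
Qed.

Lemma deep_mlp k f : deep k.+1 f ->
  exists2 net : mlp R n, mlp_has_hidden net & forall x, mlp_eval zeta net x = f x.
Proof.
move=> /deep_vnet/(vnet_mlp _ _ _ (MLPOut 1%:M 0))[net /= hnet e].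
by exists net => // x; rewrite e /= mulmx1 addr0 mxE eqxx mulr1n.
Qed.

Lemma deep_shallow k f g : shallow zeta g -> deep k f -> deep k.+1 (fun x => g (f x)).
Proof.
move=> sg df; elim: sg => {g} [w b|c|g h _ dg _ dh|c g _ dg].
- by apply: deep_act; apply: deep_add; [exact: deep_scale|exact: deep_cst].
- exact: deep_cst.
- exact: deep_add dg dh.
- exact: deep_scale dg.
Qed.

End networks.

(** * Iterative approximation of the absolute value *)

Fixpoint abs_iter {R : realType} (t : R) (k : nat) : R :=
  if k is k'.+1 then abs_iter t k' + (t ^+ 2 - abs_iter t k' ^+ 2) / 2 else 0.

(** A Stone-Weierstrass iteration built from squares, sums and multiples only. With [s = |t|], the
    error [e] becomes [e (1 - s + e / 2)], at most [e (1 - e / 2)] by the extra invariant [e <= s];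
    this recursion decays like [2 / (k + 2)]. *)
Lemma abs_iter_error {R : realType} (t : R) k : `|t| <= 1 ->
  0 <= `|t| - abs_iter t k <= 2 / (k%:R + 2).
Proof.
move=> t1; suff : [&& 0 <= `|t| - abs_iter t k, `|t| - abs_iter t k <= `|t| &
    `|t| - abs_iter t k <= 2 / (k%:R + 2)].
  by move=> /and3P[-> _ ->].
elim: k => [|k] /=.
  by rewrite subr0 normr_ge0 lexx add0r divff// t1.
rewrite -(real_normK (num_real t)) -[k.+1%:R]natr1; set s := `|t| in t1 *.
set e := s - abs_iter t k => /and3P[e0 es ek].
have -> : s - (abs_iter t k + (s ^+ 2 - abs_iter t k ^+ 2) / 2) =
  e * (1 - s + e / 2) by rewrite /e; field.
have k0 : 0 <= k%:R :> R by [].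
set b : R := 2 / (k%:R + 2) in ek.
have b1 : b <= 1 by rewrite ler_pdivrMr; lra.
(* [e (1 - e / 2)] increases with [e] on [[0, 1]], so it suffices to evaluate it at the bound
   [b]. *)
have bb : b * (1 - b / 2) <= 2 / (k%:R + 1 + 2).
  rewrite ler_pdivlMr; last by lra.
  rewrite /b; have -> : 2 / (k%:R + 2) * (1 - 2 / (k%:R + 2) / 2) * (k%:R + 1 + 2) =
    2 * ((k%:R + 1) * (k%:R + 3)) / (k%:R + 2) ^+ 2 :> R by field; lra.
  by rewrite ler_pdivrMr; nra.
apply/and3P; split.
- by rewrite mulr_ge0//; lra.
- by nra.
- by apply: (le_trans _ bb); nra.
Qed.

(** * The closure of deep networks as an algebra and a lattice *)

Section approximation.
Context {R : realType} {n : nat} {E : Type}.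
Variables (zeta : R -> R) (Phi : E -> 'rV[R]_n) (K : set E).
Hypothesis czeta : continuous zeta.
Hypothesis nazeta : ~ is_affine_fun zeta.
Hypothesis Phi_bounded : forall i, exists M, forall x, K x -> `|Phi x 0 i| <= M.
Implicit Types (f : E -> R) (e : R).

(** The depth may vary with the tolerance, because each squaring costs a layer. *)
Definition approximable f := forall e, 0 < e ->
  exists k g, deep zeta n k g /\ forall x, K x -> `|f x - g (Phi x)| <= e.

(** Squares are approximated on bounded intervals only, hence the need to control the range of a
    network over [K]. *)
Lemma deep_bounded k g : deep zeta n k g ->
  exists2 M, 0 <= M & forall x, K x -> `|g (Phi x)| <= M.
Proof.
elim=> {k g} [a b|k c|k f g _ [M M0 fM] _ [L L0 gL]|k c f _ [M M0 fM]|k f _ [M M0 fM]].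
- have [M MP] := choice Phi_bounded.
  exists (\sum_i `|M i| * `|a i 0| + `|b|).
    by rewrite addr_ge0// sumr_ge0// => i _; rewrite mulr_ge0.
  move=> x Kx; rewrite (le_trans (ler_normD _ _))// lerD2r mxE.
  rewrite (le_trans (ler_norm_sum _ _ _))//; apply: ler_sum => i _.
  by rewrite normrM ler_wpM2r// (le_trans (MP i x Kx))// ler_norm.
- by exists `|c|.
- exists (M + L); first exact: addr_ge0.
  by move=> x Kx; rewrite (le_trans (ler_normD _ _))// lerD ?fM ?gL.
- exists (`|c| * M); first by rewrite mulr_ge0.
  by move=> x Kx; rewrite normrM ler_wpM2l// fM.
- have [L L0 zL] := continuous_bounded_segment zeta M czeta.
  by exists L => // x Kx; apply: zL; apply: fM.
Qed.

(** An extra layer imitates the identity through [t = ((t + 1)^2 - t^2 - 1) / 2]; the bound [M + 1]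
    covers both [t] and [t + 1]. *)
Lemma deep_lift k g e : deep zeta n k g -> 0 < e ->
  exists2 g', deep zeta n k.+1 g' & forall x, K x -> `|g (Phi x) - g' (Phi x)| <= e.
Proof.
move=> dg e0; have [M M0 gM] := deep_bounded _ _ dg.
have [s ss sP] := shallow_sqr zeta (M + 1) e czeta nazeta e0.
pose s' t := 1 / 2 * ((s (1 * t + 1) + (- 1) * s t) + - 1).
exists (fun x => s' (g x)).
  apply: (deep_shallow _ _ _ _ s') => //; apply: shallow_scale.
  apply: shallow_add; last exact: shallow_cst.
  by apply: shallow_add; [exact: shallow_affine_arg|exact: shallow_scale].
move=> x /gM; set t := g (Phi x) => tM.
have s0 := sP t ltac:(lra).
have s1 := sP (1 * t + 1) ltac:(rewrite mul1r (le_trans (ler_normD _ _))// normr1; lra).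
by move: s0 s1; rewrite /s' !ler_norml; lra.
Qed.

Lemma deep_lift_le k l g e : deep zeta n k g -> (k <= l)%N -> 0 < e ->
  exists2 g', deep zeta n l g' & forall x, K x -> `|g (Phi x) - g' (Phi x)| <= e.
Proof.
move=> dg /subnK <-; elim: (l - k)%N e => [|m IH] e e0.
  by exists g => // x _; rewrite subrr normr0 ltW.
have [g1 dg1 g1P] := IH (e / 2) ltac:(lra).
have [g2 dg2 g2P] := deep_lift _ _ (e / 2) dg1 ltac:(lra).
exists g2 => // x Kx; have := g1P x Kx; have := g2P x Kx.
by rewrite !ler_norml; lra.
Qed.

Lemma approximable_deep k g : deep zeta n k g -> approximable (fun x => g (Phi x)).
Proof. by move=> dg e e0; exists k, g; split=> // x _; rewrite subrr normr0 ltW. Qed.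

Lemma approximable_limit f :
  (forall e, 0 < e -> exists2 g, approximable g & forall x, K x -> `|f x - g x| <= e) ->
  approximable f.
Proof.
move=> H e e0; have [g ag gP] := H (e / 2) ltac:(lra).
have [k [h [dh hP]]] := ag (e / 2) ltac:(lra).
exists k, h; split=> // x Kx; have := gP x Kx; have := hP x Kx.
by rewrite !ler_norml; lra.
Qed.

Lemma approximable_eq f g : (forall x, K x -> f x = g x) ->
  approximable f -> approximable g.
Proof.
move=> fg af; apply: approximable_limit => e e0; exists f => // x Kx.
by rewrite fg// subrr normr0 ltW.
Qed.

Lemma approximable_bounded f : approximable f ->
  exists2 M, 0 <= M & forall x, K x -> `|f x| <= M.
Proof.
move=> /(_ 1 ltr01)[k [g [dg gP]]]; have [M M0 gM] := deep_bounded _ _ dg.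
exists (M + 1); first by lra.
by move=> x Kx; have := gP x Kx; have := gM x Kx; rewrite !ler_norml; lra.
Qed.

Lemma approximable_cst c : approximable (fun=> c).
Proof. exact: (approximable_deep 0%N (fun=> c) (deep_cst _ _ _ _)). Qed.

(** Depths may differ, so both networks are first lifted to the larger one; two approximations and
    two lifts account for the four quarters of [e]. *)
Lemma approximable_add f g : approximable f -> approximable g ->
  approximable (fun x => f x + g x).
Proof.
move=> af ag e e0.
have [k [f' [df fP]]] := af (e / 4) ltac:(lra).
have [l [g' [dg gP]]] := ag (e / 4) ltac:(lra).
have [f2 df2 f2P] := deep_lift_le _ _ _ (e / 4) df (leq_maxl k l) ltac:(lra).
have [g2 dg2 g2P] := deep_lift_le _ _ _ (e / 4) dg (leq_maxr k l) ltac:(lra).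
exists (maxn k l), (fun x => f2 x + g2 x); split; first exact: deep_add.
move=> x Kx; have := fP x Kx; have := gP x Kx; have := f2P x Kx; have := g2P x Kx.
by rewrite !ler_norml; lra.
Qed.

Lemma approximable_scale c f : approximable f -> approximable (fun x => c * f x).
Proof.
move=> af e e0; have c1 : 0 < `|c| + 1 by rewrite ltr_wpDl.
have [k [g [dg gP]]] := af (e / (`|c| + 1)) (divr_gt0 e0 c1).
exists k, (fun x => c * g x); split; first exact: deep_scale.
move=> x Kx; rewrite -mulrBr normrM; apply: le_trans (ler_wpM2l _ (gP x Kx)) _ => //.
by rewrite mulrCA ler_piMr ?(ltW e0)// ler_pdivrMr// mul1r lerDl.
Qed.

Lemma approximable_sub f g : approximable f -> approximable g ->
  approximable (fun x => f x - g x).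
Proof.
move=> af ag; have := approximable_add _ _ af (approximable_scale (- 1) _ ag).
by apply: approximable_eq => x _; rewrite mulN1r.
Qed.

Lemma approximable_sqr f : approximable f -> approximable (fun x => f x ^+ 2).
Proof.
move=> af; have [M M0 fM] := approximable_bounded _ af.
apply: approximable_limit => e e0.
(* When [g] is within 1 of [f], [|g| <= M + 1] and the factor [|f + g|] is at most [2 M + 1]. *)
pose e' := Num.min 1 (e / (2 * M + 1)).
have M1 : 0 < 2 * M + 1 by lra.
have e'0 : 0 < e' by rewrite lt_min ltr01 divr_gt0.
have [k [g [dg gP]]] := af _ e'0.
exists (fun x => g (Phi x) ^+ 2).
  move=> d d0; have [L L0 gL] := deep_bounded _ _ dg.
  have [s ss sP] := shallow_sqr zeta L d czeta nazeta d0.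
  exists k.+1, (fun x => s (g x)); split; first exact: deep_shallow.
  by move=> x Kx; rewrite distrC; apply: sP; exact: gL.
move=> x Kx; have := gP x Kx; rewrite le_min => /andP[g1 ge].
rewrite subr_sqr normrM.
apply: (@le_trans _ _ (e / (2 * M + 1) * (2 * M + 1))); last first.
  by rewrite divfK// gt_eqF.
apply: ler_pM => //; have := fM x Kx; move: g1.
by rewrite !ler_norml; lra.
Qed.

Lemma approximable_abs f : approximable f -> approximable (fun x => `|f x|).
Proof.
move=> af; have [M M0 fM] := approximable_bounded _ af.
have M1 : 0 < M + 1 by lra.
(* Rescaling into [[-1, 1]], the range where [abs_iter_error] applies. *)
pose h x := (M + 1)^-1 * f x.
have ah : approximable h by exact: approximable_scale.
have h1 x : K x -> `|h x| <= 1.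
  move=> Kx; rewrite normrM normfV (gtr0_norm M1) ler_pdivrMl// mulr1.
  by rewrite (le_trans (fM x Kx))// lerDl.
have it k : approximable (fun x => abs_iter (h x) k).
  elim: k => [|k IH]; first exact: approximable_cst.
  apply: approximable_add => //.
  have := approximable_scale (2^-1) _
    (approximable_sub _ _ (approximable_sqr _ ah) (approximable_sqr _ IH)).
  by apply: approximable_eq => x _; rewrite mulrC.
suff : approximable (fun x => `|h x|).
  move/(approximable_scale (M + 1)); apply: approximable_eq => x _.
  by rewrite normrM normfV (gtr0_norm M1) mulVKf// gt_eqF.
apply: approximable_limit => e e0.
exists (fun x => abs_iter (h x) (Num.bound (2 / e))) => // x Kx.
have /andP[k0 k1] := abs_iter_error _ (Num.bound (2 / e)) (h1 _ Kx).
rewrite ger0_norm// (le_trans k1)// ler_pdivrMr; last by rewrite ltr_wpDl.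
have := archi_boundP (divr_ge0 (ler0n R 2) (ltW e0)).
rewrite ltr_pdivrMr// mulrDr mulrC; lra.
Qed.

Lemma approximable_min f g : approximable f -> approximable g ->
  approximable (fun x => Num.min (f x) (g x)).
Proof.
move=> af ag.
have := approximable_scale (2^-1) _ (approximable_sub _ _ (approximable_add _ _ af ag)
  (approximable_abs _ (approximable_sub _ _ af ag))).
by apply: approximable_eq => x _; rewrite minr_absE mulrC distrC.
Qed.

Lemma approximable_sum (I : Type) (r : seq I) (F : I -> E -> R) :
  (forall i, approximable (F i)) -> approximable (fun x => \sum_(i <- r) F i x).
Proof.
move=> aF; elim: r => [|i r IH].
  by apply: approximable_eq (approximable_cst 0) => x _; rewrite big_nil.
apply: approximable_eq (approximable_add _ _ (aF i) IH) => x _.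
by rewrite big_cons.
Qed.

(** One more lift ensures a hidden layer even for approximants of depth zero. *)
Lemma approximable_mlp f e : approximable f -> 0 < e ->
  exists2 net : mlp R n, mlp_has_hidden net &
    forall x, K x -> `|f x - mlp_eval zeta net (Phi x)| < e.
Proof.
move=> af e0; have [k [g [dg gP]]] := af (e / 4) ltac:(lra).
have [g1 dg1 g1P] := deep_lift _ _ (e / 4) dg ltac:(lra).
have [net hnet netE] := deep_mlp _ _ _ _ dg1.
exists net => // x Kx; rewrite netE; have := gP x Kx; have := g1P x Kx.
by rewrite !ler_norml ltr_norml; lra.
Qed.

End approximation.

(** * Continuous functions on compact sets as limits of minima of cones *)

Section density.
Context {R : realType}.

Lemma continuous_bounded_compact (T : topologicalType) (f : T -> R) (K : set T) :
  continuous f -> compact K -> exists M, forall x, K x -> `|f x| <= M.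
Proof.
move=> cf cK.
have /compact_bounded [M [_ MP]] : compact (f @` K : set R^o).
  by apply: continuous_compact => //; exact: continuous_subspaceT.
by exists (M + 1) => x Kx; apply: (MP (M + 1)); [rewrite ltrDl|exists x].
Qed.

Lemma continuous_lincomb (T : topologicalType) m (c : 'I_m -> R) (F : 'I_m -> T -> R) :
  (forall k, continuous (F k)) -> continuous (fun x => \sum_k c k * F k x).
Proof.
move=> cF; apply: (@continuous_big R^o _ +%R 0 xpredT) => [|k _].
  exact: (@add_continuous R^o).
by move=> x; apply: cvgM; [exact: cvg_cst|exact: cF].
Qed.

(** Chosen because it is built from coordinates by operations that preserve approximability:
    differences, absolute values and sums. *)
Definition l1dist (N D : nat) (X Y : 'M[R]_(N, D)) : R :=
  \sum_i \sum_j `|X i j - Y i j|.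

Lemma l1dist_ge0 N D (X Y : 'M[R]_(N, D)) : 0 <= l1dist N D X Y.
Proof. by apply: sumr_ge0 => i _; apply: sumr_ge0. Qed.

Lemma entry_le_l1dist N D (X Y : 'M[R]_(N, D)) i j : `|X i j - Y i j| <= l1dist N D X Y.
Proof.
rewrite /l1dist (bigD1 i)//= (bigD1 j)//= -addrA lerDl addr_ge0//.
  by apply: sumr_ge0.
by apply: sumr_ge0 => k _; apply: sumr_ge0.
Qed.

(* [f] is the limit of minima of finitely many cones [f p + e + L_p |X - p|],
   each lying above [f] on [K] and close to [f] near its apex [p]. *)
Lemma continuous_approximable (N D n : nat) (zeta : R -> R)
    (Phi : 'M[R]_(N, D) -> 'rV[R]_n) (K : set 'M[R]_(N, D)) (f : 'M[R]_(N, D) -> R) :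
  continuous zeta -> ~ is_affine_fun zeta ->
  (forall i, exists M, forall x, K x -> `|Phi x 0 i| <= M) ->
  (forall i j, approximable zeta Phi K (fun X => X i j)) ->
  compact K -> continuous f -> approximable zeta Phi K f.
Proof.
move=> cz naz bPhi acoord cK cf; apply: approximable_limit => e e0.
have [M fM] := continuous_bounded_compact _ _ _ cf cK.
have cone p : exists L, 0 <= L /\
    (K p -> forall x, K x -> f x <= f p + e / 2 + L * l1dist _ _ x p).
  have /cvgrPdist_lt/(_ (e / 2)) := @cf p.
  rewrite divr_gt0// => /(_ isT) /nbhs_ballP[d /= d0 dP].
  (* Within distance [d] of the apex continuity suffices; beyond it the slope has lifted the cone by
     at least [2 |M|], which bounds the variation of [f] on [K]. *)
  exists (2 * `|M| / d); split=> [|Kp x Kx]; first by rewrite divr_ge0 ?(ltW d0)// mulr_ge0.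
  have [xd|xd] := ltP (l1dist _ _ x p) d.
    have := dP x; rewrite /ball/= /mx_ball => /(_ _)/ltW.
    have -> : 2 * `|M| / d * l1dist _ _ x p = 2 * `|M| * l1dist _ _ x p / d.
      by rewrite mulrAC.
    have L0 : 0 <= 2 * `|M| * l1dist _ _ x p / d.
      by rewrite divr_ge0 ?(ltW d0)// !mulr_ge0// l1dist_ge0.
    move=> H; suff : `|f p - f x| <= e / 2 by rewrite ler_norml; lra.
    apply: H; split=> // i j; rewrite /ball/= distrC.
    exact: le_lt_trans (entry_le_l1dist _ _ _ _ _ _) xd.
  have := fM x Kx; have := fM p Kp; have := ler_norm M.
  have : 2 * `|M| <= 2 * `|M| / d * l1dist _ _ x p.
    by rewrite mulrAC ler_pdivlMr// ler_wpM2l// mulr_ge0.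
  by rewrite !ler_norml; lra.
have [L LP] := choice cone.
pose phi p x := f p + e / 2 + L p * l1dist _ _ x p.
have near_apex p : nbhs p [set x | phi p x < f x + e].
  have /cvgrPdist_lt/(_ (e / 4)) := @cf p.
  rewrite divr_gt0// => /(_ isT) pe.
  (* The distance has [N * D] terms, each at most [e / 4 / b], so the cone rises by at most [e / 4];
     the summand 1 keeps [b] positive. *)
  pose b := L p * (N * D)%:R + 1.
  have b0 : 0 < b by rewrite ltr_wpDl// mulr_ge0//; case: (LP p).
  have : \forall x \near p, ball p (e / 4 / b) x.
    by apply: nbhsx_ballx; rewrite !divr_gt0.
  apply: filterS2 pe => x fx [_ xb] /=; rewrite /phi.
  suff : L p * l1dist _ _ x p <= e / 4 by move: fx; rewrite ltr_norml; lra.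
  apply: (@le_trans _ _ (L p * ((N * D)%:R * (e / 4 / b)))).
    apply: ler_wpM2l; first by case: (LP p).
    have -> : (N * D)%:R * (e / 4 / b) = \sum_(i < N) \sum_(j < D) (e / 4 / b).
      by rewrite !sumr_const !card_ord -mulrnA mulnC -[RHS]mulr_natl.
    apply: ler_sum => i _; apply: ler_sum => j _; rewrite distrC ltW//.
    exact: xb.
  have -> : L p * ((N * D)%:R * (e / 4 / b)) = e / 4 * (L p * (N * D)%:R / b) by ring.
  by rewrite ler_piMr// ?ler_pdivrMr ?mul1r ?lerDl//; lra.
have aphi p : approximable zeta Phi K (phi p).
  apply: approximable_add => //; first exact: approximable_cst.
  apply: approximable_scale; apply: approximable_sum => // i.
  apply: approximable_sum => // j; apply: approximable_abs => //.
  by apply: approximable_sub => //; exact: approximable_cst.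
have lower (s : seq 'M[R]_(N, D)) : {in s, forall p, K p} ->
    exists2 g, approximable zeta Phi K g & forall x, K x ->
      f x <= g x /\ forall p, p \in s -> g x <= phi p x.
  elim: s => [_|p s IH ps].
    (* The minimum over no cone starts from the constant [M], an upper bound of [f] on [K]. *)
    exists (fun=> M); first exact: approximable_cst.
    by move=> x Kx; split=> //; exact: le_trans (ler_norm _) (fM x Kx).
  have [q qs|g ag gP] := IH; first by apply: ps; rewrite in_cons qs orbT.
  exists (fun x => Num.min (phi p x) (g x)); first exact: approximable_min.
  move=> x Kx; have [fg gs] := gP x Kx; split.
    by rewrite le_min fg andbT; apply: (LP p).2 => //; apply: ps; rewrite mem_head.
  move=> q; rewrite in_cons => /orP[/eqP->|/gs gq]; first by rewrite ge_min lexx.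
  by rewrite ge_min gq orbT.
(* Each cone stays below [f + e] near its apex, and finitely many of these neighbourhoods cover
   [K]. *)
have := cK; rewrite compact_cover => /(_ _ K (fun p => interior [set x | phi p x < f x + e])).
case=> [p _|p Kp|s sK sP]; first exact: open_interior.
  by exists p => //; exact: near_apex.
have [g ag gP] := lower (finmap.enum_fset s) ltac:(by move=> p /sK; rewrite inE).
exists g => // x Kx; have [fg gs] := gP x Kx.
have [p /= ps /interior_subset /= px] := sP x Kx.
by have := gs p ps; rewrite ler_norml; lra.
Qed.

End density.

(** * Convolution on the complete graph *)

Section graph_convolution.
Context {R : realType}.

Lemma norm_adj_complete (N : nat) (i j : 'I_N) :
  norm_adj R (@complete_graph N) i j = N%:R^-1.
Proof.
have adj k l : complete_graph k l || (k == l) by rewrite /complete_graph; case: eqP.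
have degE k : gdeg (@complete_graph N) k = N.
  rewrite /gdeg -[RHS]card_ord; apply: eq_card => l.
  by rewrite [RHS]inE; apply: mem_set; exact: adj.
by rewrite mxE adj !degE -expr2 sqrtr_sqr normr_nat.
Qed.

(** The matrix averages over all nodes, and averaging twice changes nothing. *)
Lemma norm_adj_complete_idem (N : nat) : (0 < N)%N ->
  norm_adj R (@complete_graph N) *m norm_adj R (@complete_graph N) =
  norm_adj R (@complete_graph N).
Proof.
move=> N0; apply/matrixP => i j; rewrite mxE.
under eq_bigr do rewrite !norm_adj_complete.
rewrite sumr_const card_ord -[LHS]mulr_natl mulrA divff ?mul1r ?norm_adj_complete//.
by rewrite pnatr_eq0 -lt0n.
Qed.

(** Idempotence gives [A Y = A X (1 + W)], from which [A X W] is recovered and subtracted. *)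
Lemma conv_res_inverse (N D : nat) (W : 'M[R]_D) (X : 'M[R]_(N, D)) :
  (0 < N)%N -> 1%:M + W \in unitmx ->
  let A := norm_adj R (@complete_graph N) in let Y := conv_res (@complete_graph N) W X in
  X = Y - A *m Y *m (invmx (1%:M + W) *m W).
Proof.
move=> N0 uW /=; rewrite /conv_res; set A := norm_adj R _.
have -> : A *m (A *m X *m W + X) = A *m X *m (1%:M + W).
  by rewrite !mulmxDr mulmx1 !mulmxA norm_adj_complete_idem// addrC.
by rewrite -[A *m X *m _ *m (_ *m _)]mulmxA mulKVmx// [RHS]addrC addKr.
Qed.

(** If [v (1 + W) = 0] then [v = - v W]; comparing at a coordinate of largest modulus gives
    [|v_j| <= a D |v_j|] with [a D < 1]. *)
Lemma unitmx_1D_small (D : nat) (W : 'M[R]_D) (a : R) :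
  a * D%:R < 1 -> (forall i j, `|W i j| <= a) -> 1%:M + W \in unitmx.
Proof.
move=> aD Wa; rewrite -row_free_unit; apply: inj_row_free => v.
rewrite mulmxDr mulmx1 => /eqP; rewrite addr_eq0 => /eqP vW.
apply/rowP => i0; rewrite [RHS]mxE.
have [j _ jmax] := @Order.TotalTheory.arg_maxP _ _ _ i0 predT (fun i => `|v 0 i|) isT.
suff vj : `|v 0 j| <= 0.
  by apply/eqP; rewrite -normr_le0; apply: le_trans (jmax i0 isT) vj.
have : `|v 0 j| <= `|v 0 j| * (a * D%:R).
  rewrite {1}vW mxE normrN mxE (le_trans (ler_norm_sum _ _ _))//.
  have -> : `|v 0 j| * (a * D%:R) = \sum_(i < D) `|v 0 j| * a.
    by rewrite sumr_const card_ord mulrA mulr_natr.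
  by apply: ler_sum => i _; rewrite normrM ler_pM//; exact: jmax.
by have := normr_ge0 (v 0 j); nra.
Qed.

Lemma dense_gnn_class (zeta : R -> R) (N D : nat) (W : 'M[R]_D) :
  continuous zeta -> ~ is_affine_fun zeta -> (0 < N)%N -> 1%:M + W \in unitmx ->
  dense_ucc (gnn_class zeta (@complete_graph N) W).
Proof.
move=> cz naz N0 uW f cf K cK e e0.
pose Y X := conv_res (@complete_graph N) W X.
pose Phi X := mxvec (Y X).
have YE X i j : Y X i j =
    \sum_k W k j * \sum_l norm_adj R (@complete_graph N) i l * X l k + X i j.
  by rewrite !mxE; congr (_ + _); apply: eq_bigr => k _; rewrite mulrC !mxE.
have bPhi i : exists M, forall X, K X -> `|Phi X 0 i| <= M.
  case/mxvec_indexP: i => i j.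
  have cY : continuous (fun X => Y X i j).
    have -> : (fun X => Y X i j) = fun X : 'M[R]_(N, D) => \sum_k W k j *
        \sum_l norm_adj R (@complete_graph N) i l * X l k + X i j.
      by apply/funext => X; exact: YE.
    have cadd (T : topologicalType) (F G : T -> R) : continuous F -> continuous G ->
        continuous (fun x => F x + G x).
      by move=> cF cG x; apply: cvgD; [exact: cF|exact: cG].
    apply: cadd; last exact: coord_continuous.
    apply: continuous_lincomb => k; apply: continuous_lincomb => l.
    exact: coord_continuous.
  have [M MP] := continuous_bounded_compact _ _ _ cY cK.
  by exists M => X KX; rewrite /Phi mxvecE; exact: MP.
have aY i j : approximable zeta Phi K (fun X => Y X i j).
  (* Entries of [Y X] are exact outputs of depth-zero networks: a coordinate column selects them
     from [Phi X]. *)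
  have := approximable_deep zeta Phi K 0%N _
    (deep_affine zeta _ (delta_mx (mxvec_index i j) 0) 0).
  apply: approximable_eq => // X _; rewrite addr0 mxE.
  rewrite (bigD1 (mxvec_index i j))//= big1 => [|k kij].
    by rewrite [delta_mx _ _ _ _]mxE !eqxx mulr1 addr0 /Phi mxvecE.
  by rewrite [delta_mx _ _ _ _]mxE (negbTE kij) mulr0.
pose V := invmx (1%:M + W) *m W.
have aX i j : approximable zeta Phi K (fun X => X i j).
  (* This is an entry of the inverse map, linear in the entries of [Y X]. *)
  have : approximable zeta Phi K (fun X => Y X i j - \sum_k V k j *
      \sum_l norm_adj R (@complete_graph N) i l * Y X l k).
    apply: approximable_sub => //; apply: approximable_sum => // k.
    apply: approximable_scale; apply: approximable_sum => // l.
    exact: approximable_scale.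
  apply: approximable_eq => // X _.
  rewrite [in RHS](conv_res_inverse _ _ W X N0 uW) -/(Y X) -/V [in RHS]mxE.
  congr (_ + _); move: (norm_adj R _) V (Y X) => A V' Z; rewrite !mxE; congr (- _).
  by apply: eq_bigr => k _; rewrite mulrC mxE.
have af := continuous_approximable _ _ _ _ _ _ _ cz naz bPhi aX cK cf.
have [net hnet netP] := approximable_mlp _ _ _ cz naz bPhi _ _ af e0.
by exists (fun X => mlp_eval zeta net (Phi X)) => //; exists net.
Qed.

End graph_convolution.

(** * Gaussian tail estimates *)

Section gaussian_tail.
Context {R : realType}.

Lemma measurable_normr_gt (a : R) : measurable [set x : R | a < `|x|].
Proof.
rewrite [X in measurable X](_ : _ = setT `&` (@Num.norm R R) @^-1` `]a, +oo[).
  exact: normr_measurable.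
by apply/seteqP; split=> x /=; rewrite in_itv/= andbT => // -[].
Qed.

(* On [a < |x|] half of the Gaussian exponent is at least [a^2 / (4 s^2)]; the
   other half is the exponent of the density with variance [2 s^2]. *)
Lemma normal_prob_tail (s a : R) : 0 < s -> 0 <= a ->
  (normal_prob 0 s [set x : R | (a < `|x|)%R] <= (2 * expR (- (a ^+ 2 / (4 * s ^+ 2))))%:E)%E.
Proof.
move=> s0 a0; set A := [set x | _]; set c := expR _.
have mA : measurable A by exact: measurable_normr_gt.
pose s2 := Num.sqrt 2 * s.
have q0 : 0 < Num.sqrt 2 :> R by rewrite sqrtr_gt0.
have s20 : 0 < s2 by rewrite mulr_gt0.
have s2E : s2 ^+ 2 = 2 * s ^+ 2 by rewrite exprMn sqr_sqrtr.
have q2 : Num.sqrt 2 <= 2 :> R.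
  by rewrite -[leRHS]ger0_norm// -sqrtr_sqr ler_wsqrtr// expr2 -natrM ler_nat.
(* The ratio of the two peaks is [sqrt 2], which the final constant rounds up to 2. *)
have peakE : normal_peak s = Num.sqrt 2 * normal_peak s2.
  rewrite /normal_peak s2E.
  have -> : 2 * s ^+ 2 * pi *+ 2 = 2 * (s ^+ 2 * pi *+ 2) :> R by ring.
  by rewrite (sqrtrM (s ^+ 2 * pi *+ 2))// invfM mulVKf// gt_eqF.
have pdf_le x : A x -> normal_pdf 0 s x <= 2 * c * normal_pdf 0 s2 x.
  move=> ax; rewrite !normal_pdfE ?gt_eqF// /normal_fun peakE s2E !subr0.
  have -> : 2 * c * (normal_peak s2 * expR (- x ^+ 2 / (2 * s ^+ 2 *+ 2))) =
    2 * normal_peak s2 * (c * expR (- x ^+ 2 / (2 * s ^+ 2 *+ 2))) by ring.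
  apply: ler_pM; rewrite ?expR_ge0 ?mulr_ge0 ?normal_peak_ge0 ?(ltW q0)//.
    by rewrite ler_wpM2r ?normal_peak_ge0.
  rewrite -expRD ler_expR.
  have : a ^+ 2 <= x ^+ 2.
    by rewrite -(real_normK (num_real x)) lerXn2r ?nnegrE// ltW.
  have -> : - x ^+ 2 / (s ^+ 2 *+ 2) =
    - x ^+ 2 / (4 * s ^+ 2) - x ^+ 2 / (4 * s ^+ 2) by field; rewrite gt_eqF.
  have -> : - x ^+ 2 / (2 * s ^+ 2 *+ 2) = - x ^+ 2 / (4 * s ^+ 2).
    by field; rewrite gt_eqF.
  move=> ax2; rewrite [leRHS]addrC lerD2l lerN2 ler_wpM2r// invr_ge0 mulr_ge0//.
  exact: sqr_ge0.
have c0 : 0 <= 2 * c by rewrite mulr_ge0 ?expR_ge0.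
have mpdf m t : measurable_fun A (EFin \o normal_pdf m t).
  by apply/measurable_EFinP; apply: measurable_funTS; exact: measurable_normal_pdf.
rewrite /normal_prob.
apply: (@le_trans _ _ (\int[lebesgue_measure]_(x in A)
    ((2 * c)%:E * (normal_pdf 0 s2 x)%:E))%E).
  apply: ge0_le_integral => //.
  - by move=> x _; rewrite lee_fin normal_pdf_ge0.
  - exact: mpdf.
  - by apply: measurable_funeM; exact: mpdf.
rewrite ge0_integralZl_EFin//; last 2 first.
- by move=> x _; rewrite lee_fin normal_pdf_ge0.
- exact: mpdf.
rewrite -[leRHS]mule1; apply: lee_wpmul2l; first by rewrite lee_fin.
rewrite -(integral_normal_pdf 0 s2); apply: ge0_subset_integral => //.
- by apply/measurable_EFinP; exact: measurable_normal_pdf.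
- by move=> x _; rewrite lee_fin normal_pdf_ge0.
Qed.

Lemma union_bound (d : measure_display) (T : measurableType d) (P : probability T R)
    (I : Type) (r : seq I) (B : I -> set T) (c : R) :
  (forall i, measurable (B i)) -> (forall i, P (B i) <= c%:E)%E ->
  measurable (\big[setU/set0]_(i <- r) B i) /\
  (P (\big[setU/set0]_(i <- r) B i) <= ((size r)%:R * c)%:E)%E.
Proof.
move=> mB PB; elim: r => [|i r [mU PU]].
  by rewrite big_nil measure0 mul0r.
rewrite big_cons; split; first exact: measurableU.
apply: (le_trans (measureU2 P (mB i) mU)).
by rewrite /= -natr1 mulrDl mul1r addrC EFinD leeD.
Qed.

(** The factors [D], [D] and [2] are each at most [exp D], and [3 <= 79 / 4 = 81 / 4 - 1 / 2]. *)
Lemma tail_numeric (D : nat) : (0 < D)%N ->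
  (D * D)%:R * (2 * expR (- (81 * D%:R / 4))) <= expR (- D%:R / 2) :> R.
Proof.
move=> D0.
have D1 : 1 <= D%:R :> R by rewrite ler1n.
have De : D%:R <= expR D%:R :> R by have := expR_ge1Dx (D%:R : R); lra.
have e2 : 2 <= expR D%:R :> R by have := expR_ge1Dx (D%:R : R); lra.
have -> : expR (- D%:R / 2) = expR (79 * D%:R / 4) * expR (- (81 * D%:R / 4)) :> R.
  by rewrite -expRD; congr expR; field.
rewrite mulrA ler_pM2r ?expR_gt0//.
apply: (@le_trans _ _ (expR D%:R * expR D%:R * expR D%:R)).
  by rewrite natrM !ler_pM ?mulr_ge0.
by rewrite -!expRD ler_expR; lra.
Qed.

(** The complement of the finite union of tail events is measurable; it later serves as an explicit
    event inside the set of outcomes with a dense class. *)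
Lemma gaussian_matrix_small (d : measure_display) (T : measurableType d)
    (P : probability T R) (D : nat) (s : R) (W : 'I_D -> 'I_D -> T -> R) :
  (0 < D)%N -> 0 < s -> iid_gaussian_matrix P s W ->
  exists2 E : set T,
    measurable E /\ E `<=` [set w | forall i j, `|W i j w| <= 9 * s * Num.sqrt D%:R]
    & (P E >= (1 - expR (- D%:R / 2))%:E)%E.
Proof.
move=> D0 s0 [mW [WN _]]; set a := 9 * s * _.
have a0 : 0 <= a by rewrite !mulr_ge0 ?sqrtr_ge0 ?(ltW s0).
pose B (ij : 'I_D * 'I_D) := W ij.1 ij.2 @^-1` [set x | a < `|x|].
have mA : measurable [set x : R | a < `|x|] by exact: measurable_normr_gt.
have mB ij : measurable (B ij) by rewrite -[B ij]setTI; exact: mW.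
have PB ij : (P (B ij) <= (2 * expR (- (81 * D%:R / 4)))%:E)%E.
  rewrite /B WN//; apply: le_trans (normal_prob_tail _ _ s0 a0) _.
  rewrite lee_fin ler_pM2l// ler_expR lerN2 le_eqVlt; apply/orP; left; apply/eqP.
  (* With [a = 9 s sqrt D] the exponent [a^2 / (4 s^2)] is [81 D / 4]. *)
  rewrite /a !exprMn sqr_sqrtr//; field; rewrite gt_eqF//.
have [mU PU] := union_bound _ _ P _ (enum {: 'I_D * 'I_D}) B _ mB PB.
exists (~` \big[setU/set0]_(ij <- enum {: 'I_D * 'I_D}) B ij).
  split; first exact: measurableC.
  move=> w /= Hw i j; rewrite leNgt; apply/negP => aW; apply: Hw.
  rewrite -bigcup_seq; exists (i, j) => //=; exact: mem_enum.
rewrite probability_setC// EFinB leeB//.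
by apply: le_trans PU _; rewrite lee_fin -cardE card_prod card_ord tail_numeric.
Qed.

End gaussian_tail.

Theorem theorem3 (R : realType) (zeta : R -> R)
  (hzeta : continuous zeta)
  (hact : ~ is_polynomial_fun zeta \/
          (~ is_affine_fun zeta /\
           exists t : R, C1_at zeta t /\ derive1 zeta t != 0))
  (N D : nat) (hN : (0 < N)%N) (hD : (0 < D)%N)
  (s : R) (hs0 : 0 < s) (hs1 : s < (9 * D%:R * Num.sqrt D%:R)^-1)
  (d : measure_display) (T : measurableType d) (P : probability T R)
  (W : 'I_D -> 'I_D -> T -> R) (hW : iid_gaussian_matrix P s W) :
  exists2 E : set T, measurable E /\
      E `<=` [set w | dense_ucc
                (gnn_class zeta (@complete_graph N) (\matrix_(i, j) W i j w))]
    & (P E >= (1 - expR (- D%:R / 2))%:E)%E.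
Proof.
have naz : ~ is_affine_fun zeta.
  (* In the first case, an affine [zeta] would be a polynomial of degree at most one. *)
  case: hact => [np|[]//] [a [b ab]]; apply: np; exists (a *: 'X + b%:P) => x.
  by rewrite ab !hornerE.
have [E [mE EW] PE] := gaussian_matrix_small d T P D s W hD hs0 hW.
exists E => //; split=> // w /EW Ww; apply: dense_gnn_class => //.
apply: (unitmx_1D_small _ _ (9 * s * Num.sqrt D%:R)) => [|i j]; last first.
  by rewrite mxE; exact: Ww.
have D0 : 0 < 9 * D%:R * Num.sqrt D%:R :> R.
  by rewrite !mulr_gt0 ?sqrtr_gt0 ?ltr0n.
(* The bound on [s] says exactly that [9 s sqrt D] times [D] is below 1. *)
move: hs1; rewrite -[X in _ < X]mul1r ltr_pdivlMr//.
by congr (_ < _); ring.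
Qed.
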